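(* For every integer $t\ge 0$, $$W_t(x)=\sum_{k=0}^\infty w(t,k)x^k=c(x)^{t+1}$$ as formal power series in $x$.
   Context: A Temperley-Lieb diagram $t\to n$ is a planar non-crossing perfect matching (up to isotopy) of $t$ points on a bottom line and $n$ points on a top line, drawn in the strip between the lines; it is monic if every bottom point is joined to a top point. The cell module $W_t(n)$ of the Temperley-Lieb algebra $TL_n(q)$ has basis the monic diagrams $t\to n$. For $t,k\ge0$, $w(t,k):=\dim W_t(t+2k)$, the number of monic diagrams $t\to t+2k$ (with $w(0,0)=1$, the empty diagram). $W_t(x):=\sum_{k\ge0}w(t,k)x^k$. Put $c(n):=w(0,n)$ for $n\ge0$, so $c(0)=1$, and $c(x):=\sum_{n=0}^\infty c(n)x^n$. *)

(* Defs.v *)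
From mathcomp Require Import all_boot all_order all_algebra.

Set Implicit Arguments.
Unset Strict Implicit.
Unset Printing Implicit Defensive.

Import GRing.Theory.
Local Open Scope ring_scope.

(* Marked points of the strip: inl i is the i-th bottom point and inr j the
   j-th top point, both numbered from left to right. *)
Definition point (t n : nat) := ('I_t + 'I_n)%type.

(* Position of a point on the boundary of the strip, read along the bottom
   line from left to right and then back along the top line from right to
   left. *)
Definition bpos (t n : nat) (p : point t n) : nat :=
  match p with
  | inl i => i
  | inr j => (t + (n - j.+1))%N
  end.

(* A perfect matching is encoded as the fixed-point-free involution sending
   each point to its partner. *)
Definition perfect_matching (t n : nat) (m : {ffun point t n -> point t n}) :=
  [forall p, (m (m p) == p) && (m p != p)].

(* A matching can be drawn in the strip without crossings iff no two of its
   arcs have interleaved endpoints along the boundary; the drawing is then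
   unique up to isotopy. *)
Definition noncrossing (t n : nat) (m : {ffun point t n -> point t n}) :=
  [forall p, forall q,
     ~~ [&& bpos p < bpos q, bpos q < bpos (m p) & bpos (m p) < bpos (m q)]%N].

Definition TL_diagram (t n : nat) : {set {ffun point t n -> point t n}} :=
  [set m | perfect_matching m && noncrossing m].

Definition monic (t n : nat) (m : {ffun point t n -> point t n}) :=
  [forall i : 'I_t, exists j : 'I_n, m (inl i) == inr j].

(* The basis of the cell module W_t(n). *)
Definition monic_diagram (t n : nat) : {set {ffun point t n -> point t n}} :=
  [set m in TL_diagram t n | monic m].

Definition w (t k : nat) : nat := #|monic_diagram t (t + 2 * k)|.

Definition c (n : nat) : nat := w 0 n.

(* A formal power series is its sequence of coefficients; equality of series
   is equality of all coefficients, f =1 g. *)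
Definition fps (R : nzRingType) := nat -> R.

Definition fps_one (R : nzRingType) : fps R := fun n => (n == 0%N)%:R.

(* Cauchy product. *)
Definition fps_mul (R : nzRingType) (f g : fps R) : fps R :=
  fun n => \sum_(i < n.+1) f i * g (n - i)%N.

Definition fps_exp (R : nzRingType) (f : fps R) (m : nat) : fps R :=
  iter m (fps_mul f) (fps_one R).

Definition W_series (t : nat) : fps int := fun k => (w t k)%:Z.

Definition c_series : fps int := fun n => (c n)%:Z.

(* Main.v *)
Require Import Defs.
From mathcomp Require Import all_boot all_order all_algebra.
From mathcomp Require Import zify.

(** The first bottom point of a monic diagram from t+1 to n+1 points is joined
    to some top point j. By planarity this arc separates the strip: the j top
    points to its left are matched among themselves, giving a diagram from 0 to
    j, while everything to its right is a monic diagram from t to n-j. Any two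
    such diagrams can be put on the two sides of the arc, so, writing Q(t, n)
    for the number of monic diagrams,
      Q(t+1, n+1) = sum over j <= n of Q(t, n-j) Q(0, j)
    ([card_monic_diagram_rec]). The factor Q(0, j) vanishes for odd j, since a
    perfect matching needs an even number of points, and Q(t, n-j) vanishes for
    n-j < t, since a monic diagram injects the bottom line into the top line.
    With n = t+2k only j = 2i with i <= k survive, and the recurrence becomes
    w(t+1, k) = sum of c(i) w(t, k-i), that is W_(t+1)(x) = c(x) W_t(x)
    ([w_rec]). As W_0 = c, induction on t gives the result.

    The cut along the arc is made for noncrossing matchings of an arbitrary
    finite type whose points have positions in nat and of which some are marked
    as bottom points ([card_arc_split]); a relabelling of the points
    ([card_relabel]) brings the marked points of the strip to that form. *)

Set Implicit Arguments.
Unset Strict Implicit.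
Unset Printing Implicit Defensive.

Import GRing.Theory.

(** * Noncrossing matchings of a finite type with positions *)

(** The condition on [bot], that no arc joins two bottom points, is monicity:
    the points outside [bot] are the top points. *)
Definition nc_matching (T : finType) (pos : T -> nat) (bot : pred T) :
    {set {ffun T -> T}} :=
  [set m : {ffun T -> T} |
    [&& [forall p, m (m p) == p], [forall p, m p != p],
        [forall p, forall q,
           ~~ [&& pos p < pos q, pos q < pos (m p) & pos (m p) < pos (m q)]]
      & [forall p, bot p ==> ~~ bot (m p)]]].

Lemma nc_matchingP (T : finType) (pos : T -> nat) (bot : pred T)
    (m : {ffun T -> T}) :
  reflect [/\ forall p, m (m p) = p, forall p, m p <> p,
              forall p q, ~ [/\ pos p < pos q, pos q < pos (m p)
                              & pos (m p) < pos (m q)]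
            & forall p, bot p -> ~~ bot (m p)]
          (m \in nc_matching pos bot).
Proof.
rewrite inE; apply: (iffP and4P) => -[h1 h2 h3 h4]; split.
- by move=> p; apply/eqP; move/forallP: h1.
- by move=> p; apply/eqP; move/forallP: h2.
- by move=> p q /and3P; apply/negP; move/forallP/(_ p)/forallP: h3.
- by move=> p; apply/implyP; move/forallP: h4.
- by apply/forallP => p; apply/eqP.
- by apply/forallP => p; apply/eqP.
- by apply/forallP => p; apply/forallP => q; apply/negP => /and3P; apply: h3.
- by apply/forallP => p; apply/implyP; apply: h4.
Qed.

Lemma eq_nc_matching (T : finType) (pos pos' : T -> nat) (bot bot' : pred T) :
  (forall p q, (pos p < pos q) = (pos' p < pos' q)) -> bot =1 bot' ->
  nc_matching pos bot = nc_matching pos' bot'.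
Proof.
move=> eq_pos eq_bot; apply/setP => m; rewrite !inE; congr [&& _, _, _ & _].
  by apply: eq_forallb => p; apply: eq_forallb => q; rewrite !eq_pos.
by apply: eq_forallb => p; rewrite !eq_bot.
Qed.

(** Matchings are conjugated by the bijection h; the prescribed arc from a to b
    is carried along, as the recurrence counts matchings containing it. *)
Lemma card_relabel (T T' : finType) (pos : T -> nat) (bot : pred T)
    (h : T' -> T) (a b : T') :
  bijective h ->
  #|[set m in nc_matching pos bot | m (h a) == h b]| =
  #|[set m in nc_matching (pos \o h) (bot \o h) | m a == b]|.
Proof.
move=> [g hK gK].
pose conj (m : {ffun T' -> T'}) : {ffun T -> T} := [ffun p => h (m (g p))].
have conjE m x : conj m (h x) = h (m x) by rewrite ffunE hK.
have conj_bij : bijective conj.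
  exists (fun m : {ffun T -> T} => [ffun p => g (m (h p))] : {ffun T' -> T'}) => m.
    by apply/ffunP => p; rewrite ffunE conjE hK.
  by apply/ffunP => p; rewrite !ffunE !gK.
rewrite -(on_card_preimset (onW_bij _ conj_bij)).
apply: eq_card => m; rewrite !inE conjE (can_eq hK); congr (_ && _).
have all_h (P : pred T) : [forall p, P p] = [forall p, P (h p)].
  apply/forallP/forallP => H p; first exact: H.
  by rewrite -[p]gK; apply: H.
rewrite !all_h; congr [&& _, _, _ & _].
- by apply: eq_forallb => p; rewrite !conjE (can_eq hK).
- by apply: eq_forallb => p; rewrite !conjE (can_eq hK).
- apply: eq_forallb => p; rewrite all_h.
  by apply: eq_forallb => q /=; rewrite !conjE.
- by apply: eq_forallb => p /=; rewrite !conjE.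
Qed.

(** The points below their partner and the points above it are exchanged by
    the matching. *)
Lemma nc_matching_even (T : finType) (pos : T -> nat) (bot : pred T)
    (m : {ffun T -> T}) :
  injective pos -> m \in nc_matching pos bot -> ~~ odd #|T|.
Proof.
move=> pos_inj /nc_matchingP [mK m_fpf _ _].
pose lo := [set p | pos p < pos (m p)].
have -> : #|T| = #|lo|.*2.
  rewrite -(cardsC lo) -addnn; congr (_ + _).
  rewrite -(card_imset lo (can_inj mK)); apply: eq_card => p.
  rewrite inE; apply/idP/imsetP => [p_hi | [q q_lo ->]].
    exists (m p); rewrite ?mK // inE mK.
    move: p_hi; rewrite inE -leqNgt leq_eqVlt => /orP[/eqP e|//].
    by case: (m_fpf p); apply: pos_inj.
  by move: q_lo; rewrite !inE mK -leqNgt => /ltnW.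
by rewrite odd_double.
Qed.

(** * Cutting along an arc *)

Section ArcSplit.

Variables A B : finType.

(** The points seen from an arc: [None] and [Some None] are its two ends, A
    are the points it encloses and B the points beyond it. *)
Local Notation cut := (option (option (A + B))).
Local Notation inner a := (Some (Some (inl a)) : cut).
Local Notation outer b := (Some (Some (inr b)) : cut).

Variables (pos : cut -> nat) (bot : pred cut).
Hypothesis first_end : forall x, pos None < pos (Some x).
Hypothesis inner_before : forall a, pos (inner a) < pos (Some None).
Hypothesis outer_after : forall b, pos (Some None) < pos (outer b).
Hypothesis second_end_top : ~~ bot (Some None).

Local Notation posA := (fun a => pos (inner a)).
Local Notation posB := (fun b => pos (outer b)).
Local Notation botA := (fun a => bot (inner a)).
Local Notation botB := (fun b => bot (outer b)).

Definition glue (fg : {ffun A -> A} * {ffun B -> B}) : {ffun cut -> cut} :=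
  [ffun p => match p with
             | None => Some None
             | Some None => None
             | Some (Some (inl a)) => inner (fg.1 a)
             | Some (Some (inr b)) => outer (fg.2 b)
             end].

Lemma glue_inj : injective glue.
Proof.
move=> [f g] [f' g'] e; congr pair; apply/ffunP => x.
  by move/ffunP/(_ (inner x)): e; rewrite !ffunE => -[].
by move/ffunP/(_ (outer x)): e; rewrite !ffunE => -[].
Qed.

(** No two arcs of a glued matching can interleave unless both lie in A or
    both lie in B, as the blocks [None], A, [Some None], B come in this order. *)
Lemma glue_nc_matching fg :
  (glue fg \in nc_matching pos bot) =
  (fg.1 \in nc_matching posA botA) && (fg.2 \in nc_matching posB botB).
Proof.
case: fg => f g /=; apply/idP/andP.
  move=> /nc_matchingP [mK m_fpf m_nc m_bot].
  split; apply/nc_matchingP; split.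
  - by move=> a; move: (mK (inner a)); rewrite !ffunE => -[].
  - by move=> a e; apply: (m_fpf (inner a)); rewrite ffunE /= e.
  - by move=> a a'; move: (m_nc (inner a) (inner a')); rewrite !ffunE.
  - by move=> a; move: (m_bot (inner a)); rewrite !ffunE.
  - by move=> b; move: (mK (outer b)); rewrite !ffunE => -[].
  - by move=> b e; apply: (m_fpf (outer b)); rewrite ffunE /= e.
  - by move=> b b'; move: (m_nc (outer b) (outer b')); rewrite !ffunE.
  - by move=> b; move: (m_bot (outer b)); rewrite !ffunE.
move=> [/nc_matchingP[fK f_fpf f_nc f_bot] /nc_matchingP[gK g_fpf g_nc g_bot]].
apply/nc_matchingP; split.
- by move=> [[[a|b]|]|]; rewrite !ffunE /= ?fK ?gK.
- move=> [[[a|b]|]|]; rewrite !ffunE //= => -[]; first exact: f_fpf.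
  exact: g_fpf.
- move=> [[[a|b]|]|] [[[a'|b']|]|]; rewrite !ffunE /=;
    try (by apply: f_nc); try (by apply: g_nc); case;
    repeat match goal with
    | |- context [pos (Some (Some (inl ?a)))] =>
        move: (inner_before a) (first_end (Some (inl a)));
        generalize (pos (Some (Some (inl a))))
    | |- context [pos (Some (Some (inr ?b)))] =>
        move: (outer_after b); generalize (pos (Some (Some (inr b))))
    end; move: (first_end None); lia.
- move=> [[[a|b]|]|]; rewrite !ffunE //=; first exact: f_bot.
    exact: g_bot.
  by rewrite (negbTE second_end_top).
Qed.

(** The arc joining the two ends cannot be crossed, so a matching containing it
    preserves A and B. *)
Lemma arc_glue m :
  m \in nc_matching pos bot -> m None = Some None -> exists fg, m = glue fg.
Proof.
move=> /nc_matchingP [mK _ m_nc _] m_arc.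
have m_arc' : m (Some None) = None by rewrite -m_arc mK.
have m_inner a : exists a', m (inner a) = inner a'.
  case e: (m (inner a)) => [[[a'|b]|]|]; first by exists a'.
  - case: (m_nc None (inner a)); rewrite m_arc e.
    by split; [apply: first_end | apply: inner_before | apply: outer_after].
  - by move: (mK (inner a)); rewrite e m_arc'.
  - by move: (mK (inner a)); rewrite e m_arc.
have m_outer b : exists b', m (outer b) = outer b'.
  case e: (m (outer b)) => [[[a|b']|]|]; last 3 first.
  - by exists b'.
  - by move: (mK (outer b)); rewrite e m_arc'.
  - by move: (mK (outer b)); rewrite e m_arc.
  by have [a' e'] := m_inner a; move: (mK (outer b)); rewrite e e'.
exists ([ffun a => if m (inner a) is Some (Some (inl a')) then a' else a],
        [ffun b => if m (outer b) is Some (Some (inr b')) then b' else b]).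
apply/ffunP => -[[[a|b]|]|]; rewrite !ffunE //=.
  by have [a' ->] := m_inner a.
by have [b' ->] := m_outer b.
Qed.

Lemma card_arc_split :
  #|[set m in nc_matching pos bot | m None == Some None]| =
  #|nc_matching posA botA| * #|nc_matching posB botB|.
Proof.
rewrite -cardsX -(card_imset _ glue_inj); apply: eq_card => m; rewrite inE.
apply/andP/imsetP => [[m_nc /eqP m_arc] | [fg]].
  have [fg m_fg] := arc_glue m_nc m_arc.
  by exists fg; rewrite // inE -glue_nc_matching -m_fg.
by rewrite inE -glue_nc_matching => fg_nc ->; rewrite fg_nc ffunE.
Qed.

End ArcSplit.

(** * The recurrence for monic diagrams *)

Definition is_bottom (t n : nat) (p : point t n) : bool :=
  if p is inl _ then true else false.

Lemma monic_diagramE t n :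
  monic_diagram t n = nc_matching (@bpos t n) (@is_bottom t n).
Proof.
apply/setP => m; rewrite !inE.
have -> : Defs.monic m =
          [forall p, is_bottom p ==> ~~ is_bottom (m p)].
  apply/forallP/forallP => [mon [i|j] //= | mon i].
    by have /existsP[j /eqP ->] := mon i.
  move: (mon (inl i)) => /=; case: (m (inl i)) => [//|j] _.
  by apply/existsP; exists j.
have -> : perfect_matching m =
          [forall p, m (m p) == p] && [forall p, m p != p].
  apply/forallP/andP => [m_pm | [/forallP mK /forallP m_fpf] p].
    by split; apply/forallP => p; case/andP: (m_pm p).
  by rewrite mK m_fpf.
by rewrite -!andbA.
Qed.

Lemma bpos_inj t n : injective (@bpos t n).
Proof.
move=> [i|i] [j|j] /= e; have := ltn_ord i; have := ltn_ord j.
- by move=> _ _; congr inl; apply: val_inj.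
- by lia.
- by lia.
- by move=> lt_j lt_i; congr inr; apply: val_inj => /=; lia.
Qed.

Lemma monic_diagram0_odd n : odd n -> #|monic_diagram 0 n| = 0.
Proof.
move=> n_odd; apply/eqP; rewrite cards_eq0 -subset0; apply/subsetP => m.
rewrite monic_diagramE => /(nc_matching_even (@bpos_inj 0 n)).
by rewrite card_sum !card_ord n_odd.
Qed.

Lemma monic_diagram_small t n : n < t -> #|monic_diagram t n| = 0.
Proof.
move=> lt_nt; apply/eqP; rewrite cards_eq0 -subset0; apply/subsetP => m.
rewrite monic_diagramE => /nc_matchingP [mK _ _ m_bot].
have top i : {j | m (inl i) = inr j}.
  move: (m_bot (inl i) isT); case: (m (inl i)) => [//|j] _; by exists j.
have top_inj : injective (fun i => sval (top i)).
  move=> i i'; case: (top i) (top i') => [j e] [j' e'] /= ejj'.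
  by have [] : @inl _ 'I_n i = inl i' by rewrite -(mK (inl i)) e ejj' -e' mK.
by have := leq_card _ top_inj; rewrite !card_ord leqNgt lt_nt.
Qed.

Section FirstArc.

Variables (t n : nat) (j : 'I_n.+1).

(** The points of the strip as seen from an arc from the first bottom point to
    the top point j: along the boundary, the points to the right of the arc
    come between its ends and those to the left come after them. The value at
    a bottom point to the left is arbitrary, since 'I_0 is empty. *)
Definition strip_of_cut (p : option (option (point t (n - j) + point 0 j))) :
    point t.+1 n.+1 :=
  match p with
  | None => inl ord0
  | Some None => inr j
  | Some (Some (inl (inl i))) => inl (lift ord0 i)
  | Some (Some (inl (inr a))) => inr (inord (j.+1 + a))
  | Some (Some (inr (inl i))) => inl ord0
  | Some (Some (inr (inr b))) => inr (inord b)
  end.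

Lemma bpos_right (p : point t (n - j)) :
  bpos (strip_of_cut (Some (Some (inl p)))) = (bpos p).+1.
Proof.
case: p => [i|a] //=; rewrite inordK; move: (ltn_ord a) (ltn_ord j); lia.
Qed.

Lemma bpos_left (p : point 0 j) :
  bpos (strip_of_cut (Some (Some (inr p)))) = bpos p + (t + (n - j)).+2.
Proof.
case: p => [[]//|b] /=; rewrite inordK; move: (ltn_ord b) (ltn_ord j); lia.
Qed.

Lemma bpos_lt t' n' (p : point t' n') : bpos p < t' + n'.
Proof. by case: p => [i|i] /=; move: (ltn_ord i); lia. Qed.

Lemma bpos_arc_end :
  bpos (strip_of_cut (Some None)) = (t + (n - j)).+1.
Proof. by rewrite /=; move: (ltn_ord j); lia. Qed.

Lemma strip_of_cut_bij : bijective strip_of_cut.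
Proof.
apply: inj_card_bij; last first.
  rewrite !card_option !card_sum !card_ord; move: (ltn_ord j); lia.
move=> p q /(congr1 (@bpos _ _)).
case: p q => [[[p|p]|]|] [[[q|q]|]|];
  rewrite ?bpos_right ?bpos_left ?bpos_arc_end //=.
- by move=> [/bpos_inj ->].
- by have := bpos_lt p; lia.
- by have := bpos_lt p; lia.
- by have := bpos_lt q; lia.
- by move=> /addIn/bpos_inj ->.
- by lia.
- by lia.
- by have := bpos_lt q; lia.
- by lia.
- by lia.
Qed.

Lemma card_first_arc :
  #|[set m in monic_diagram t.+1 n.+1 | m (inl ord0) == inr j]| =
  #|monic_diagram t (n - j)| * #|monic_diagram 0 j|.
Proof.
rewrite monic_diagramE (card_relabel _ _ None (Some None) strip_of_cut_bij).
rewrite card_arc_split //=.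
- rewrite !monic_diagramE; congr (_ * _).
    by rewrite (eq_nc_matching (pos' := @bpos _ _) (bot' := @is_bottom _ _))
       // => [p q | [] //]; rewrite !bpos_right.
  rewrite (eq_nc_matching (pos' := @bpos _ _) (bot' := @is_bottom _ _))
    // => [p q | [[]|] //]; by rewrite !bpos_left ltn_add2r.
- move=> x /=; suff : 0 < bpos (strip_of_cut (Some x)) by [].
  by case: x => [[p|p]|]; rewrite ?bpos_right ?bpos_left ?bpos_arc_end ?addnS.
- move=> p; suff : bpos (strip_of_cut (Some (Some (inl p)))) <
                   bpos (strip_of_cut (Some None)) by [].
  by rewrite bpos_right bpos_arc_end ltnS bpos_lt.
- move=> p; suff : bpos (strip_of_cut (Some None)) <
                   bpos (strip_of_cut (Some (Some (inr p)))) by [].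
  by rewrite bpos_left bpos_arc_end; lia.
Qed.

End FirstArc.

Lemma card_monic_diagram_rec t n :
  #|monic_diagram t.+1 n.+1| =
  \sum_(j < n.+1) #|monic_diagram t (n - j)| * #|monic_diagram 0 j|.
Proof.
pose partner (m : {ffun point t.+1 n.+1 -> point t.+1 n.+1}) :=
  if m (inl ord0) is inr j then j else ord0.
rewrite -sum1_card (partition_big partner xpredT) //=.
apply: eq_bigr => j _; rewrite -card_first_arc -sum1_card.
apply: eq_bigl => m; rewrite [RHS]inE; apply: andb_id2l.
rewrite inE => /andP[_ /forallP/(_ ord0)/existsP[j' /eqP e]].
by rewrite /partner e.
Qed.

(** * Generating series *)

Lemma sum_even_terms (F : nat -> nat) k :
  (forall j, odd j -> F j = 0) ->
  \sum_(0 <= j < (2 * k).+1) F j = \sum_(i < k.+1) F (2 * i).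
Proof.
move=> F_odd; elim: k => [|k IH]; first by rewrite big_nat1 big_ord1.
rewrite big_ord_recr -IH mulnS add2n.
by rewrite big_nat_recr // big_nat_recr //= F_odd ?addn0 //= oddM.
Qed.

Lemma w_rec t k : w t.+1 k = \sum_(i < k.+1) c i * w t (k - i).
Proof.
rewrite /w addSn card_monic_diagram_rec.
pose F j := #|monic_diagram t (t + 2 * k - j)| * #|monic_diagram 0 j|.
(* Beyond j = 2k too few top points remain on the right of the arc. *)
rewrite -(big_mkord xpredT F) (@big_cat_nat _ _ _ (2 * k).+1) //=; last first.
  by rewrite ltnS leq_addl.
rewrite [X in _ + X]big_nat_cond [X in _ + X]big1 => [|j].
  rewrite addn0 sum_even_terms => [|j j_odd]; last first.
    by rewrite /F monic_diagram0_odd ?muln0.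
  apply: eq_bigr => i _; rewrite [RHS]mulnC /c /w add0n.
  by rewrite mulnBr addnBA // leq_mul2l -ltnS ltn_ord.
rewrite andbT => /andP[lt_kj lt_jn]; rewrite /F monic_diagram_small //.
by lia.
Qed.

Local Open Scope ring_scope.

Lemma fps_mulr1 (R : nzRingType) (f : fps R) : fps_mul f (fps_one R) =1 f.
Proof.
move=> n; rewrite /fps_mul big_ord_recr /= subnn mulr1 big1 ?add0r // => i _.
by rewrite /fps_one subn_eq0 leqNgt ltn_ord mulr0.
Qed.

Theorem proposition4p5 (t : nat) : W_series t =1 fps_exp c_series t.+1.
Proof.
elim: t => [|t IH] k; first by rewrite /fps_exp /= fps_mulr1.
rewrite /W_series w_rec (big_morph Posz PoszD (erefl _)).
by apply: eq_bigr => i _; rewrite PoszM; congr (_ * _); apply: IH.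
Qed.
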